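(* Let $z$ be a quadratic surd with respect to $\Gamma$. Let $\{a_n\}_{n\ge0}$ be a continued fraction expansion of $z$ over $\Gamma$, $\{z_n\}_{n\ge0}$ the corresponding iteration sequence and $\{q_n\}_{n\ge0}$ the associated denominator sequence. Suppose that either $\{z_n\}$ is of radius $r<1$ or $\{|q_n|\}$ is monotonic. Then the following hold. (i) There exist $\zeta\in\mathbb{C}'$ and $a\in\Gamma$ such that $z_n=\zeta$ and $a_n=a$ for infinitely many $n\in\mathbb{N}$; if, moreover, $\{a_n\}$ is associated with an algorithm, then $\{a_n\}$ is eventually periodic (that is, there exist $k\ge1$ and $n_0$ such that $a_{n+k}=a_n$ for all $n\ge n_0$). (ii) If $\{z_n\}$ is of radius $r<1$ and also the sequence $\{|q_n|\}$ is monotonic, then the sets $\{z_n\mid n\in\mathbb{N}\}$ and $\{a_n\mid n\in\mathbb{N}\}$ are finite.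
   Context: Throughout, $\Gamma$ is a discrete Euclidean subring of $\mathbb{C}$ containing $1$ and spanning $\mathbb{C}$, i.e. one of $\mathbb{Z}[i]$, $\mathbb{Z}[\sqrt{2}\,i]$, $\mathbb{Z}[\frac12(1+\sqrt3\,i)]$, $\mathbb{Z}[\frac12(1+\sqrt7\,i)]$, $\mathbb{Z}[\frac12(1+\sqrt{11}\,i)]$. $K\subset\mathbb{C}$ is its quotient field and $\mathbb{C}'=\mathbb{C}\setminus K$. $\mathbb{N}=\{1,2,\dots\}$. A quadratic surd with respect to $\Gamma$ is a root of a quadratic polynomial with coefficients in $\Gamma$ which is not contained in $K$. Continued fraction expansion: for $z\in\mathbb{C}'$, a continued fraction expansion of $z$ (over $\Gamma$) is a sequence $\{a_n\}_{n\ge0}$ in $\Gamma$ for which there is a sequence $\{z_n\}_{n\ge 0}$ in $\mathbb{C}$ (the iteration sequence) with $z_0=z$ and, for all $n\ge0$, $0<|z_n-a_n|<1$ and $z_{n+1}=(z_n-a_n)^{-1}$. No further rule for the choice of $a_n$ is imposed. The denominator sequence $\{q_n\}$ is given by $q_{-1}=0$, $q_0=1$, $q_n=a_nq_{n-1}+q_{n-2}$ for $n\ge1$. The radius of the iteration sequence is $\sup_{n\ge1}|z_n-a_n|$. An algorithm is a function $f:\mathbb{C}'\to\Gamma$ with $|\zeta-f(\zeta)|<1$ for all $\zeta\in\mathbb{C}'$; the expansion $\{a_n\}$ is associated with the algorithm $f$ if $a_n=f(z_n)$ for all $n\ge0$. *)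

(* Defs.v *)
From HB Require Import structures.
From mathcomp Require Import all_boot all_order all_algebra.
From mathcomp Require Import all_classical all_reals all_analysis.
From mathcomp Require Export complex.

Set Implicit Arguments.
Unset Strict Implicit.
Unset Printing Implicit Defensive.

Import Order.TTheory GRing.Theory Num.Theory.
Local Open Scope classical_set_scope.
Local Open Scope ring_scope.

(* Throughout, C is modelled by R[i] with R : realType; the modulus `|x| is
   then an element of R[i] with zero imaginary part. *)

Section ContinuedFractions.
Variable R : realType.
Local Notation C := R[i].
Implicit Types (G : set C) (a zs : nat -> C) (f : C -> C) (z w : C).

Definition int_adjoin w : set C :=
  [set x | exists p : {poly int}, x = (map_poly intr p).[w]].

Definition euclidean_generators : seq C :=
  [:: Complex 0 1;
      Complex 0 (Num.sqrt 2);
      Complex (1 / 2) (Num.sqrt 3 / 2);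
      Complex (1 / 2) (Num.sqrt 7 / 2);
      Complex (1 / 2) (Num.sqrt 11 / 2)].

Definition euclidean_subring G : Prop :=
  exists2 w, w \in euclidean_generators & G = int_adjoin w.

Definition quotient_field G : set C :=
  [set x / y | x in G & y in G `\ 0].

Definition outside_field G : set C := ~` quotient_field G.

Definition quadratic_surd G z : Prop :=
  outside_field G z /\
  exists p : {poly C}, [/\ size p = 3%N, forall i, G p`_i & root p z].

Definition cf_expansion G z a zs : Prop :=
  [/\ forall n, G (a n),
      zs 0%N = z &
      forall n, 0 < `|zs n - a n| < 1 /\ zs n.+1 = (zs n - a n)^-1].

(* The inner [else] branch is the value q_{-1} = 0. *)
Fixpoint cf_denom a (n : nat) : C :=
  if n is n'.+1 then
    a n * cf_denom a n' + (if n' is m.+1 then cf_denom a m else 0)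
  else 1.

(* The set is bounded by 1 when zs is an iteration sequence for a, so that the
   real-valued [sup] is a genuine supremum. *)
Definition cf_radius a zs : R :=
  sup [set complex.Re `|zs n - a n| | n in [set n | (1 <= n)%N]].

Definition monotonic_modulus (u : nat -> C) : Prop :=
  nondecreasing_seq (fun n => `|u n|) \/ nonincreasing_seq (fun n => `|u n|).

(* Only the values of f on [outside_field G] are relevant. *)
Definition cf_algorithm G f : Prop :=
  forall w, outside_field G w -> G (f w) /\ `|w - f w| < 1.

Definition associated_with_algorithm G a zs : Prop :=
  exists2 f, cf_algorithm G f & forall n, a n = f (zs n).

Definition eventually_periodic a : Prop :=
  exists k n0 : nat, (1 <= k)%N /\ forall n, (n0 <= n)%N -> a (n + k)%N = a n.

End ContinuedFractions.

(* Main.v *)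
(** Write P_n, Q_n for the convergents and E_n = P_n - Q_n z, so that
    |E_(n+1)| = |E_n| |z_n - a_n|.  Whenever |z_n - a_n| <= r < 1 and
    |Q_n| <= |Q_(n+1)|, the determinant identity bounds |E_n Q_(n+1)| by
    1 / (1 - r); then z_(n+1) is a root of a quadratic polynomial over G with
    the discriminant of z and bounded coefficients, so it takes finitely many
    values.  Such n occur infinitely often: if the radius is < 1 because the
    |Q_n|^2 are naturals and cannot decrease forever, and if |Q_n| is monotonic
    because |z_n - a_n| cannot tend to 1 (an expanding orbit near finitely many
    points of the unit circle). *)

Require Import Defs.
From mathcomp Require Import all_boot all_order all_algebra.
From mathcomp Require Import all_classical all_reals all_analysis.
From mathcomp Require Import ring lra zify.
Set Implicit Arguments.
Unset Strict Implicit.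
Unset Printing Implicit Defensive.
Import Order.TTheory GRing.Theory Num.Theory.
Local Open Scope classical_set_scope.
Local Open Scope ring_scope.

(** * The modulus with values in the ordered field [R] *)

Definition cmod {R : realType} (z : R[i]) : R := complex.Re `|z|.

Section Modulus.
Variable R : realType.
Implicit Types x y z : R[i].

Lemma cmodE z : `|z| = (cmod z)%:C%C.
Proof. by []. Qed.

Lemma cmod_sqr z : cmod z ^+ 2 = complex.Re z ^+ 2 + complex.Im z ^+ 2.
Proof. by rewrite /cmod normc_def sqr_sqrtr ?addr_ge0 ?sqr_ge0. Qed.

Lemma cmod_ge0 z : 0 <= cmod z.
Proof. by rewrite /cmod normc_def sqrtr_ge0. Qed.

Lemma cmodM x y : cmod (x * y) = cmod x * cmod y.
Proof. exact: Normc.normcM. Qed.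

Lemma cmodV x : cmod x^-1 = (cmod x)^-1.
Proof. exact: Normc.normcV. Qed.

Lemma cmodN x : cmod (- x) = cmod x.
Proof. exact: normcN. Qed.

Lemma cmodD x y : cmod (x + y) <= cmod x + cmod y.
Proof. exact: le_normcD. Qed.

Lemma cmodB x y : cmod (x - y) <= cmod x + cmod y.
Proof. by rewrite -(cmodN y) cmodD. Qed.

Lemma cmod_distC x y : cmod (x - y) = cmod (y - x).
Proof. by rewrite -cmodN opprB. Qed.

Lemma cmod1 : cmod (1 : R[i]) = 1.
Proof. exact: Normc.normc1. Qed.

Lemma cmod0 : cmod (0 : R[i]) = 0.
Proof. exact: Normc.normc0. Qed.

Lemma cmod_eq0 x : (cmod x == 0) = (x == 0).
Proof. by apply/eqP/eqP => [/Normc.eq0_normc|->]; last exact: cmod0. Qed.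

Lemma cmod_gt0 x : (0 < cmod x) = (x != 0).
Proof. by rewrite lt_def cmod_eq0 cmod_ge0 andbT. Qed.

Lemma cmodJ x : cmod (x^*)%C = cmod x.
Proof. by rewrite /cmod normcJ. Qed.

Lemma ler_cmod x y : (`|x| <= `|y|) = (cmod x <= cmod y).
Proof. by rewrite !cmodE lecR. Qed.

Lemma normr_lt1 x : (`|x| < 1) = (cmod x < 1).
Proof. by rewrite cmodE -[1]/(1%:C%C) ltcR. Qed.

Lemma mulcJ x : x * (x^*)%C = (cmod x ^+ 2)%:C%C.
Proof. by rewrite -sqr_normc cmodE rmorphXn. Qed.

Lemma cmod_Im x : `|complex.Im x| <= cmod x.
Proof.
rewrite -(@ler_pXn2r _ 2) ?nnegrE ?cmod_ge0// cmod_sqr real_normK ?num_real//.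
by rewrite lerDr sqr_ge0.
Qed.

Lemma cmod_int (u : int) : cmod (u%:~R : R[i]) = `|u%:~R|.
Proof.
apply/eqP; rewrite -(@eqrXn2 _ 2) ?cmod_ge0//.
rewrite cmod_sqr real_normK ?num_real//.
by rewrite -(rmorph_int (real_complex R)) /= expr0n /= addr0.
Qed.
End Modulus.

(** * The five Euclidean rings as lattices in the plane *)

Section Lattice.
Variable R : realType.

(** As a root of X^2 - t X + n, [w] has all its powers among the integer combinations of 1 and
    [w]. *)
Lemma int_adjoin_quadratic (w : R[i]) (t n : int) :
  w + (w^*)%C = t%:~R -> w * (w^*)%C = n%:~R ->
  forall x, int_adjoin w x <-> exists u v : int, x = u%:~R + v%:~R * w.
Proof.
move=> ht hn x.
have hw : w * w = t%:~R * w - n%:~R by rewrite -ht -hn; ring.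
split=> [[p ->]|[u [v ->]]].
  elim/poly_ind: p => [|p c [u [v IH]]].
    by exists 0, 0; rewrite rmorph0 horner0 mul0r addr0.
  exists (c - v * n), (u + v * t).
  rewrite rmorphD rmorphM /= map_polyX map_polyC /= hornerD hornerMX hornerC IH.
  rewrite mulrDl -mulrA hw !(rmorphD,rmorphN,rmorphM) /=; ring.
exists (u%:P + v *: 'X).
by rewrite rmorphD /= map_polyC /= map_polyZ /= map_polyX hornerD hornerC hornerZ hornerX.
Qed.

(** Treats the five rings uniformly: the arguments below rest on the integral trace [t], the
    integral norm [n] and Im w > 0. *)
Lemma euclidean_subring_basis (G : set R[i]) : euclidean_subring G ->
  exists (w : R[i]) (t n : int), [/\ 0 < complex.Im w, w + (w^*)%C = t%:~R,
    w * (w^*)%C = n%:~R &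
    forall x, G x <-> exists u v : int, x = u%:~R + v%:~R * w].
Proof.
have wit (w : R[i]) (t n : int) : 0 < complex.Im w ->
    complex.Re w *+ 2 = t%:~R ->
    complex.Re w ^+ 2 + complex.Im w ^+ 2 = n%:~R ->
    exists (v : R[i]) (t n : int), [/\ 0 < complex.Im v, v + (v^*)%C = t%:~R,
    v * (v^*)%C = n%:~R &
    forall x, int_adjoin w x <-> exists a b : int, x = a%:~R + b%:~R * v].
  move=> w0 ht hn.
  have ht' : w + (w^*)%C = t%:~R.
    rewrite -(rmorph_int (real_complex R)) -ht.
    by case: (w) => a b; apply/eqP; rewrite eq_complex /= subrr mulr2n !eqxx.
  have hn' : w * (w^*)%C = n%:~R.
    by rewrite mulcJ cmod_sqr hn rmorph_int.
  by exists w, t, n; split=> //; apply: int_adjoin_quadratic ht' hn'.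
have s2 (x : R) : 0 <= x -> (Num.sqrt x : R) ^+ 2 = x by exact: sqr_sqrtr.
have s0 (m : nat) : (0 < m)%N -> 0 < Num.sqrt m%:R :> R.
  by move=> m0; rewrite sqrtr_gt0 ltr0n.
move=> [w + ->]; rewrite !inE.
case/or4P=> [/eqP->|/eqP->|/eqP->|/orP[]/eqP->].
- apply: (wit _ 0 1) => //=; first by rewrite mul0rn.
  by rewrite expr0n add0r expr1n.
- apply: (wit _ 0 2) => /=; [exact: s0|by rewrite mul0rn|].
  by rewrite expr0n add0r s2 ?ler0n.
- apply: (wit _ 1 1) => /=; first by rewrite divr_gt0// s0.
    by field.
  by rewrite !exprMn s2 ?ler0n//; field.
- apply: (wit _ 1 2) => /=; first by rewrite divr_gt0// s0.
    by field.
  by rewrite !exprMn s2 ?ler0n//; field.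
- apply: (wit _ 1 3) => /=; first by rewrite divr_gt0// s0.
    by field.
  by rewrite !exprMn s2 ?ler0n//; field.
Qed.

Variables (G : set R[i]) (GE : euclidean_subring G).

Lemma euclidean_subring_int (u : int) : G u%:~R.
Proof.
have [w [t [n [w0 wt wn GP]]]] := euclidean_subring_basis GE.
by apply/GP; exists u, 0; rewrite mul0r addr0.
Qed.

Lemma euclidean_subringD x y : G x -> G y -> G (x + y).
Proof.
have [w [t [n [w0 wt wn GP]]]] := euclidean_subring_basis GE.
move=> /GP[u [v ->]] /GP[u' [v' ->]]; apply/GP; exists (u + u'), (v + v').
by rewrite !rmorphD /=; ring.
Qed.

Lemma euclidean_subringM x y : G x -> G y -> G (x * y).
Proof.
have [w [t [n [w0 wt wn GP]]]] := euclidean_subring_basis GE.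
move=> /GP[u [v ->]] /GP[u' [v' ->]]; apply/GP.
exists (u * u' - v * v' * n), (u * v' + v * u' + v * v' * t).
by rewrite !(rmorphD,rmorphN,rmorphM) /= -wt -wn; ring.
Qed.

Lemma euclidean_subringN x : G x -> G (- x).
Proof.
by move=> Gx; rewrite -mulN1r; apply: euclidean_subringM Gx;
  apply: (euclidean_subring_int (-1)).
Qed.

Lemma euclidean_subringJ x : G x -> G (x^*)%C.
Proof.
have [w [t [n [w0 wt wn GP]]]] := euclidean_subring_basis GE.
(* The conjugate of [w] is t - w. *)
move=> /GP[u [v ->]]; apply/GP; exists (u + v * t), (- v).
rewrite !(rmorphD,rmorphN,rmorphM) /= !rmorph_int -wt; ring.
Qed.

(** The squared modulus is the integral norm form u^2 + t u v + n v^2. Its integrality yields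
    discreteness of [G] and, for denominators, an infinite descent. *)
Lemma euclidean_subring_cmod2 x : G x -> exists k : nat, cmod x ^+ 2 = k%:R.
Proof.
have [w [t [n [w0 wt wn GP]]]] := euclidean_subring_basis GE.
move=> /GP[u [v ->]].
pose m := u * u + u * v * t + v * v * n.
have mE : cmod (u%:~R + v%:~R * w) ^+ 2 = m%:~R.
  apply/(@complexI R); rewrite -mulcJ rmorph_int.
  rewrite !(rmorphD,rmorphM) /= !rmorph_int -wt -wn; ring.
exists `|m|%N; rewrite mE pmulrn gez0_abs//.
by rewrite -(ler0z R) -mE sqr_ge0.
Qed.

Lemma euclidean_subring_cmod_ge1 x : G x -> x != 0 -> 1 <= cmod x.
Proof.
move=> /euclidean_subring_cmod2[[|k] kE] x0.
  by move: x0; rewrite -cmod_eq0 -sqrf_eq0 kE eqxx.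
by rewrite -(@ler_pXn2r _ 2) ?nnegrE ?cmod_ge0// kE expr1n ler1n.
Qed.

Lemma finite_int_le (K : R) : finite_set [set u : int | `|u%:~R| <= K].
Proof.
pose N := `|Num.floor K|%N.+1.
apply: (@sub_finite_set _ _ ((fun k : nat => k%:Z - N%:Z) @` `I_(N + N).+1)).
  move=> u /= uK.
  have uN : `|u| <= N%:Z.
    have : `|u| <= Num.floor K by rewrite floor_ge_int intr_norm.
    rewrite /N; lia.
  exists (absz (u + N%:Z)); rewrite /=; lia.
exact/finite_image/finite_II.
Qed.

Lemma euclidean_subring_finite (K : R) : finite_set [set x | G x /\ cmod x <= K].
Proof.
have [w [t [n [w0 wt wn GP]]]] := euclidean_subring_basis GE.
(* [L] bounds v, because Im x = v Im w; then u = x - v w is bounded as well. *)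
pose L := K / complex.Im w.
apply: (@sub_finite_set _ _ ((fun p : int * int => p.1%:~R + p.2%:~R * w) @`
   ([set u : int | `|u%:~R| <= K + L * cmod w] `*` [set v : int | `|v%:~R| <= L]))).
  move=> x [/GP[u [v xE]] xK].
  have vL : `|v%:~R| <= L :> R.
    rewrite ler_pdivlMr// -(gtr0_norm w0) -normrM.
    apply: le_trans xK; apply: le_trans (cmod_Im _); rewrite xE.
    rewrite -!(rmorph_int (real_complex R)).
    by case: (w) => a b /=; rewrite add0r mul0r addr0.
  exists (u, v) => //=; split=> //=.
  have -> : `|u%:~R| = cmod (x - v%:~R * w) by rewrite xE addrK cmod_int.
  apply: le_trans (cmodB _ _) _; rewrite cmodM cmod_int.
  by rewrite lerD// ler_wpM2r// cmod_ge0.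
by apply/finite_image/finite_setX; apply: finite_int_le.
Qed.
End Lattice.

(** * Roots of quadratics with coefficients in a finite set *)

Section QuadraticRoots.
Variable R : realType.

Lemma finite_root (p : {poly R[i]}) : p != 0 -> finite_set [set x | root p x].
Proof.
move=> p0; have [s ps] := closed_field_poly_normal p.
apply: sub_finite_set (finite_seq s) => x /=.
by rewrite {1}ps rootZ ?lead_coef_eq0// root_prod_XsubC.
Qed.

Lemma finite_quadratic_roots (S : set R[i]) : finite_set S ->
  finite_set [set x | exists a b c, [/\ S a, S b, S c, (a, b, c) != 0 &
                        a * x ^+ 2 + b * x + c = 0]].
Proof.
move=> Sfin.
pose quad (t : R[i] * R[i] * R[i]) : {poly R[i]} :=
  t.1.1 *: 'X^2 + t.1.2 *: 'X + t.2%:P.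
have quadE t x : (quad t).[x] = t.1.1 * x ^+ 2 + t.1.2 * x + t.2.
  by rewrite !hornerE.
have quad0 t : t != 0 -> quad t != 0.
  apply: contraNneq => q0.
  have c i : (quad t)`_i = 0 by rewrite q0 coef0.
  have := (c 0%N, c 1%N, c 2%N).
  rewrite !(coefD, coefZ, coefXn, coefX, coefC) /= !mulr0 !mulr1 !addr0 !add0r.
  by case: t {q0 c} => [[a b] c] /= [[-> ->] ->].
apply: (@sub_finite_set _ _ (\bigcup_(t in (S `*` S `*` S) `&` [set t | t != 0])
                               [set x | root (quad t) x])).
  move=> x [a [b [c [Sa Sb Sc abc0 xE]]]].
  by exists (a, b, c) => //=; rewrite /root quadE /= xE.
apply: bigcup_finite => [|t [_ /= t0]]; last exact/finite_root/quad0.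
by apply: finite_setIl; do 2?apply: finite_setX.
Qed.
End QuadraticRoots.

(** * Convergents and the transported quadratic polynomial *)

Section Convergents.
Variable R : realType.
Implicit Types (a zs : nat -> R[i]) (u v z : R[i]).

Fixpoint cf_rec u v a (n : nat) : R[i] :=
  if n is n'.+1 then
    if n' is m.+1 then a n' * cf_rec u v a n' + cf_rec u v a m else v
  else u.

(* Both are shifted by one: cf_num a n = p_{n-1} and cf_den a n = q_{n-1}. *)
Definition cf_num a := cf_rec 1 (a 0%N) a.
Definition cf_den a := cf_rec 0 1 a.

Definition cf_err a z n := cf_num a n - cf_den a n * z.

Lemma cf_recSS u v a n :
  cf_rec u v a n.+2 = a n.+1 * cf_rec u v a n.+1 + cf_rec u v a n.
Proof. by []. Qed.

Lemma cf_numSS a n : cf_num a n.+2 = a n.+1 * cf_num a n.+1 + cf_num a n.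
Proof. by []. Qed.

Lemma cf_denSS a n : cf_den a n.+2 = a n.+1 * cf_den a n.+1 + cf_den a n.
Proof. by []. Qed.

Lemma cf_denS a n : cf_den a n.+1 = cf_denom a n.
Proof.
suff: cf_den a n.+1 = cf_denom a n /\ cf_den a n.+2 = cf_denom a n.+1 by case.
elim: n => [|n [IH1 IH2]]; first by [].
by split=> //; rewrite cf_denSS IH2 IH1.
Qed.

(** Each step multiplies the matrix of convergents by a matrix of determinant -1. *)
Lemma cf_det a n :
  cf_num a n.+1 * cf_den a n - cf_num a n * cf_den a n.+1 = (-1) ^+ n.+1.
Proof.
elim: n => [|n IH]; first by rewrite /= mulr0 mulr1 sub0r expr1.
by rewrite cf_numSS cf_denSS exprS -IH; ring.
Qed.

Variables (G : set R[i]) (z : R[i]) (a zs : nat -> R[i]).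
Hypotheses (GE : euclidean_subring G) (cfe : cf_expansion G z a zs).

Lemma cf_digit n : G (a n).
Proof. by case: cfe. Qed.

Lemma cf_step n : zs n.+1 = (zs n - a n)^-1.
Proof. by case: cfe => _ _ /(_ n)[]. Qed.

Lemma cf_frac_gt0 n : 0 < cmod (zs n - a n).
Proof. by case: cfe => _ _ /(_ n)[/andP[]]; rewrite cmod_gt0 normr_gt0. Qed.

Lemma cf_frac_lt1 n : cmod (zs n - a n) < 1.
Proof. by case: cfe => _ _ /(_ n)[/andP[_]]; rewrite normr_lt1. Qed.

Lemma cf_frac_neq0 n : zs n - a n != 0.
Proof. by rewrite -cmod_gt0 cf_frac_gt0. Qed.

Lemma cf_step_cmod n : cmod (zs n.+1) = (cmod (zs n - a n))^-1.
Proof. by rewrite cf_step cmodV. Qed.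

Lemma cf_rec_subring u v n : G u -> G v -> G (cf_rec u v a n).
Proof.
move=> Gu Gv.
suff: G (cf_rec u v a n) /\ G (cf_rec u v a n.+1) by case.
elim: n => [|n [IH1 IH2]]; first by [].
split=> //; rewrite cf_recSS; apply: (euclidean_subringD GE) => //.
by apply: (euclidean_subringM GE) => //; apply: cf_digit.
Qed.

Lemma cf_num_subring n : G (cf_num a n).
Proof.
by apply: cf_rec_subring; [exact: (euclidean_subring_int GE 1)|exact: cf_digit].
Qed.

Lemma cf_den_subring n : G (cf_den a n).
Proof.
by apply: cf_rec_subring; [exact: (euclidean_subring_int GE 0)|
  exact: (euclidean_subring_int GE 1)].
Qed.

(** The inductive step passes through E_(n+1) z_(n+1) = - E_n, which says that the Moebius map of
    the convergents sends z_(n+1) to z. *)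
Lemma cf_errS n : cf_err a z n.+1 = cf_err a z n * (a n - zs n).
Proof.
elim: n => [|n IH].
  by case: cfe => _ -> _; rewrite /cf_err /cf_num /cf_den /=; ring.
have zE : cf_err a z n.+1 * zs n.+1 = - cf_err a z n.
  by rewrite IH cf_step -(opprB (zs n)) mulrN mulNr mulfK// cf_frac_neq0.
by rewrite mulrBr zE opprK /cf_err cf_numSS cf_denSS; ring.
Qed.

Lemma cf_errS_cmod n :
  cmod (cf_err a z n.+1) = cmod (cf_err a z n) * cmod (zs n - a n).
Proof. by rewrite cf_errS cmodM cmod_distC. Qed.

Lemma cf_err_le1 n : cmod (cf_err a z n) <= 1.
Proof.
elim: n => [|n IH]; first by rewrite /cf_err /cf_num /cf_den /= mul0r subr0 cmod1.
by rewrite cf_errS_cmod mulr_ile1 ?cmod_ge0// ltW// cf_frac_lt1.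
Qed.

(** By the determinant identity E_n Q_(n+1) = E_(n+1) Q_n +- 1, and |E_(n+1) Q_n| <= r |E_n
    Q_(n+1)|; solving for |E_n Q_(n+1)| gives the bound. *)
Lemma cf_err_den_le (r : R) n : r < 1 -> cmod (zs n - a n) <= r ->
  cmod (cf_den a n) <= cmod (cf_den a n.+1) ->
  cmod (cf_err a z n) * cmod (cf_den a n.+1) <= (1 - r)^-1.
Proof.
move=> r1 zr qq.
have det : cf_err a z n * cf_den a n.+1 =
    cf_err a z n.+1 * cf_den a n - (-1) ^+ n.+1.
  by rewrite -(cf_det a) /cf_err; ring.
have m1 k : cmod ((-1) ^+ k : R[i]) = 1.
  by elim: k => [|k IH]; rewrite ?expr0 ?cmod1// exprS cmodM IH cmodN cmod1 mulr1.
rewrite -[_^-1]div1r ler_pdivlMr ?subr_gt0// -cmodM mulrBr mulr1 lerBlDr.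
rewrite {1}det (le_trans (cmodB _ _))// m1 addrC lerD2l.
rewrite !cmodM cf_errS_cmod mulrAC; apply: ler_pM => //;
  by rewrite ?mulr_ge0 ?cmod_ge0 ?ler_wpM2l ?cmod_ge0.
Qed.

Hypothesis zG : quadratic_surd G z.

Lemma quadratic_surd_coefs : exists A B C, [/\ G A, G B, G C,
  A * z ^+ 2 + B * z + C = 0 & B ^+ 2 - 4%:R * A * C != 0].
Proof.
have [zK [p [sp pG /rootP pz]]] := zG.
have {}pz : p`_2 * z ^+ 2 + p`_1 * z + p`_0 = 0.
  by rewrite -[RHS]pz horner_coef sp !big_ord_recr big_ord0 /=; ring.
exists p`_2, p`_1, p`_0; split=> //.
have A0 : p`_2 != 0.
  by have := lead_coef_eq0 p; rewrite /lead_coef sp /= => ->; rewrite -size_poly_eq0 sp.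
(* A zero discriminant makes (2 A z + B)^2 vanish, hence z = - B / (2 A) lies in the quotient
   field. *)
apply/eqP => D0; apply: zK.
have : (2%:R * p`_2 * z + p`_1) ^+ 2 = 0.
  transitivity (p`_1 ^+ 2 - 4%:R * p`_2 * p`_0
    + 4%:R * p`_2 * (p`_2 * z ^+ 2 + p`_1 * z + p`_0)); first by ring.
  by rewrite D0 pz mulr0 addr0.
move/eqP; rewrite sqrf_eq0 addr_eq0 => /eqP E.
have A20 : 2%:R * p`_2 != 0 by rewrite mulf_neq0// pnatr_eq0.
exists (- p`_1); first exact: (euclidean_subringN GE).
exists (2%:R * p`_2).
  split; last exact/eqP.
  exact: (euclidean_subringM GE (euclidean_subring_int GE 2) (pG 2%N)).
by rewrite -E mulrC mulKf.
Qed.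

(* The quadratic polynomial (A, B, C) of z is transported by the unimodular
   matrix of convergents to a polynomial (alpha n.+1, beta n, alpha n) of the
   same discriminant killed by zs n.+1; the hypotheses bound its coefficients. *)
Lemma cf_good_states_finite (r : R) : r < 1 ->
  finite_set [set zs n.+1 | n in [set n | cmod (zs n - a n) <= r /\
    cmod (cf_den a n) <= cmod (cf_den a n.+1)]].
Proof.
move=> r1; have [A [B [C [GA GB GC zE D0]]]] := quadratic_surd_coefs.
pose P := cf_num a; pose Q := cf_den a; pose E := cf_err a z.
pose alpha n := A * P n ^+ 2 + B * (P n * Q n) + C * Q n ^+ 2.
pose beta n := 2%:R * A * (P n.+1 * P n) + B * (P n.+1 * Q n + P n * Q n.+1)
               + 2%:R * C * (Q n.+1 * Q n).
(* Expand the form at P = E + Q z: the coefficient of Q^2 is A z^2 + B z + C = 0. *)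
have alphaE n : alpha n = A * E n ^+ 2 + (2%:R * A * z + B) * (E n * Q n).
  have CE : C = - (A * z ^+ 2 + B * z) by apply/eqP; rewrite -addr_eq0 addrC zE.
  by rewrite /alpha CE /E /cf_err -/(P n) -/(Q n); ring.
have rootE n : alpha n.+1 * zs n.+1 ^+ 2 + beta n * zs n.+1 + alpha n = 0.
  have PQ : P n.+1 * zs n.+1 + P n = z * (Q n.+1 * zs n.+1 + Q n).
    have zE' : E n.+1 * zs n.+1 = - E n.
      by rewrite /E cf_errS cf_step -(opprB (zs n)) mulrN mulNr mulfK// cf_frac_neq0.
    have -> : P n.+1 = E n.+1 + Q n.+1 * z by rewrite /E /cf_err subrK.
    have -> : P n = E n + Q n * z by rewrite /E /cf_err subrK.
    by rewrite mulrDl zE'; ring.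
  transitivity (A * (P n.+1 * zs n.+1 + P n) ^+ 2
     + B * ((P n.+1 * zs n.+1 + P n) * (Q n.+1 * zs n.+1 + Q n))
     + C * (Q n.+1 * zs n.+1 + Q n) ^+ 2); first by rewrite /alpha /beta; ring.
  transitivity ((Q n.+1 * zs n.+1 + Q n) ^+ 2 * (A * z ^+ 2 + B * z + C)).
    by rewrite PQ; ring.
  by rewrite zE mulr0.
(* A substitution multiplies the discriminant of a binary form by the square of its determinant,
   here 1. *)
have discE n : beta n ^+ 2 = (B ^+ 2 - 4%:R * A * C) + 4%:R * (alpha n.+1 * alpha n).
  have d2 : (P n.+1 * Q n - P n * Q n.+1) ^+ 2 = 1 by rewrite cf_det sqrr_sign.
  transitivity ((B ^+ 2 - 4%:R * A * C) * (P n.+1 * Q n - P n * Q n.+1) ^+ 2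
    + 4%:R * (alpha n.+1 * alpha n)); first by rewrite /alpha /beta; ring.
  by rewrite d2 mulr1.
have alphaG n : G (alpha n).
  have GP := cf_num_subring n; have GQ := cf_den_subring n.
  rewrite /alpha !expr2; repeat first [assumption
    | apply: (euclidean_subringM GE) | apply: (euclidean_subringD GE)].
have G2 : G 2%:R := euclidean_subring_int GE 2.
have betaG n : G (beta n).
  have GP := cf_num_subring; have GQ := cf_den_subring.
  rewrite /beta; repeat first [exact: GP | exact: GQ | assumption
    | apply: (euclidean_subringM GE) | apply: (euclidean_subringD GE)].
pose M := (1 - r)^-1.
(* [K] bounds both [alpha] values, through |E| <= 1 and |E Q| <= M. [L] dominates [K] and bounds
   [beta], because b <= b^2 + 1. *)
pose K := cmod A + cmod (2%:R * A * z + B) * M.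
pose L := cmod (B ^+ 2 - 4%:R * A * C) + 4%:R * K ^+ 2 + K + 1.
have M0 : 0 <= M by rewrite invr_ge0 subr_ge0 ltW.
have K0 : 0 <= K by rewrite addr_ge0 ?mulr_ge0 ?cmod_ge0.
have KL : K <= L.
  have : 0 <= cmod (B ^+ 2 - 4%:R * A * C) := cmod_ge0 _.
  by have := sqr_ge0 K; rewrite /L; lra.
have alpha_le n : cmod (E n) * cmod (Q n) <= M -> cmod (alpha n) <= K.
  move=> EQ; rewrite alphaE (le_trans (cmodD _ _))//.
  rewrite cmodM expr2 !cmodM lerD//; last by rewrite ler_wpM2l ?cmod_ge0.
  have E1 := cf_err_le1 n.
  by rewrite ler_piMr ?cmod_ge0// mulr_ile1 ?cmod_ge0.
apply: sub_finite_set (finite_quadratic_roots (euclidean_subring_finite GE L)).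
move=> _ [n [zr qq] <-].
have EQ' := cf_err_den_le r1 zr qq.
have a1 : cmod (alpha n) <= K.
  by apply: alpha_le; apply: le_trans EQ'; rewrite ler_wpM2l ?cmod_ge0.
have a2 : cmod (alpha n.+1) <= K.
  apply: alpha_le; apply: le_trans EQ'; rewrite /E cf_errS_cmod.
  by rewrite mulrAC ler_piMr ?mulr_ge0 ?cmod_ge0 ?ltW ?cf_frac_lt1.
have b2 : cmod (beta n) ^+ 2 <= cmod (B ^+ 2 - 4%:R * A * C) + 4%:R * K ^+ 2.
  rewrite expr2 -cmodM -expr2 discE (le_trans (cmodD _ _))// lerD2l.
  have c4 : cmod (4%:R : R[i]) = 4%:R by rewrite (cmod_int R 4) ger0_norm// ler0z.
  rewrite !cmodM c4 ler_wpM2l ?ler0n//.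
  by rewrite expr2 ler_pM ?cmod_ge0.
have bL : cmod (beta n) <= L.
  have := cmod_ge0 (beta n); move: b2 K0; rewrite /L.
  by move: (cmod (beta n)) (cmod _) => b d; nra.
exists (alpha n.+1), (beta n), (alpha n); split=> //=.
- by split=> //; apply: le_trans KL.
- by split=> //; apply: le_trans KL.
(* If all three coefficients vanished, so would the discriminant. *)
apply: contraNneq D0 => -[al be al'].
by have := discE n; rewrite be al mul0r mulr0 addr0 expr0n /= => <-.
Qed.
End Convergents.

(** * Points close to two unit circles *)

Section UnitCircles.
Variable R : realType.

Lemma seq_pos_lower_bound (l : seq R) : all (fun y => 0 < y) l ->
  exists2 s : R, 0 < s & all (fun y => s <= y) l.
Proof.
elim: l => [|x l IH] /=; first by exists 1.
move=> /andP[x0 /IH[s s0 sl]]; exists (Num.min x s); first by rewrite lt_min x0.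
rewrite ge_min lexx /=; apply: sub_all sl => y sy.
by rewrite ge_min sy orbT.
Qed.

Lemma finite_separated (S : set R[i]) : finite_set S ->
  exists2 s : R, 0 < s & forall x y, S x -> S y -> cmod (x - y) < s -> x = y.
Proof.
move=> /finite_seqP[l ->].
have [|s s0 /allP sl] := @seq_pos_lower_bound
    [seq cmod (p.1 - p.2) | p <- [seq (x, y) | x <- l, y <- l] & p.1 != p.2].
  by apply/allP => y /mapP[p]; rewrite mem_filter => /andP[pp _] ->;
    rewrite cmod_gt0 subr_eq0.
exists s => // x y /= xl yl; apply: contraTeq => xy; rewrite -leNgt.
apply: sl; apply/mapP; exists (x, y) => //.
by rewrite mem_filter xy; apply/allpairsP; exists (x, y).
Qed.

(** For nonnegative numbers |v - t| <= v + t. The estimate survives t = 0, the case of tangent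
    circles, where dividing by v + t would give no uniform bound. *)
Lemma sqr_sub_le (v t e : R) : 0 <= v -> 0 <= t -> `|v ^+ 2 - t ^+ 2| <= e ->
  (v - t) ^+ 2 <= e.
Proof.
move=> v0 t0 vte; apply: le_trans vte.
rewrite subr_sqr normrM expr2 (ger0_norm (addr_ge0 v0 t0)).
apply: le_trans (ler_norm _) _; rewrite normrM ler_wpM2l//.
by rewrite ler_norml; lra.
Qed.

(* In the coordinate z / b the common points of the two unit circles are
   1/2 +- i t with t^2 = 1/|b|^2 - 1/4. *)
Lemma unit_circles_near (z b : R[i]) (e : R) : e <= 1 ->
  1 <= cmod b -> cmod b <= 2 -> 1 <= cmod z ^+ 2 <= 1 + e ->
  1 - e <= cmod (z - b) ^+ 2 <= 1 ->
  exists w, [/\ cmod w = 1, cmod (w - b) = 1 & cmod (z - w) ^+ 2 <= 12 * e].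
Proof.
move=> e1 b1 b2 /andP[z1 z2] /andP[zb1 zb2].
have b0 : b != 0 by rewrite -cmod_gt0 (lt_le_trans ltr01).
have e0 : 0 <= e by lra.
pose s := cmod b ^+ 2.
have s1 : 1 <= s by rewrite /s expr2; nra.
have s4 : s <= 4 by rewrite /s expr2; nra.
have sV : s^-1 * s = 1 by rewrite mulVf// gt_eqF// (lt_le_trans ltr01).
have si1 : s^-1 <= 1 by rewrite invf_le1// (lt_le_trans ltr01).
have si4 : 1 / 4 <= s^-1.
  by rewrite div1r lef_pV2 ?posrE//; lra.
pose x := complex.Re (z / b); pose v := complex.Im (z / b).
have yE : x ^+ 2 + v ^+ 2 = cmod z ^+ 2 * s^-1.
  by rewrite -cmod_sqr cmodM cmodV exprMn exprVn.
have y1E : (x - 1) ^+ 2 + v ^+ 2 = cmod (z - b) ^+ 2 * s^-1.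
  rewrite -[s^-1]exprVn -exprMn -cmodV -cmodM cmod_sqr mulrBl divff//.
  by rewrite !raddfB /= subr0.
(* Subtracting [y1E] from [yE] gives 2 x - 1 = (|z|^2 - |z - b|^2) / s, and the numerator lies
   between 0 and 2 e. *)
have x1 : 0 <= x - 1 / 2 <= e by apply/andP; split; nra.
pose t := Num.sqrt (s^-1 - 1 / 4).
have t2 : t ^+ 2 = s^-1 - 1 / 4 by rewrite sqr_sqrtr// subr_ge0.
have vt : `|v ^+ 2 - t ^+ 2| <= 2 * e.
  have -> : v ^+ 2 - t ^+ 2 =
      (cmod z ^+ 2 - 1) * s^-1 - (x - 1 / 2) * (x + 1 / 2).
    by rewrite t2 mulrBl -yE; lra.
  by case/andP: x1 => xl xr; rewrite ler_norml; apply/andP; split; nra.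
(* Of the two common points, take the one on the side of [v]. *)
have [u u2 vu] : exists2 u, u ^+ 2 = t ^+ 2 & (v - u) ^+ 2 <= 2 * e.
  have t0 : 0 <= t by exact: sqrtr_ge0.
  have [v0|v0] := leP 0 v; first by exists t => //; apply: sqr_sub_le.
  exists (- t); first by rewrite sqrrN.
  rewrite -sqrrN opprB addrC; apply: sqr_sub_le => //; first by rewrite oppr_ge0 ltW.
  by rewrite sqrrN.
pose c : R[i] := Complex (1 / 2) u.
have sq1 (q : R[i]) : cmod q ^+ 2 = 1 -> cmod q = 1.
  by move/eqP; rewrite sqrf_eq1 => /orP[/eqP//|/eqP q1]; have := cmod_ge0 q; lra.
have cc (r : R) : r ^+ 2 = 1 / 4 -> s * (r ^+ 2 + u ^+ 2) = 1.
  by move=> ->; rewrite u2 t2 addrC subrK mulrC.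
exists (b * c); split.
- by apply: sq1; rewrite cmodM exprMn [X in _ * X]cmod_sqr cc//=; field.
- apply: sq1; rewrite -[X in _ - X]mulr1 -mulrBr cmodM exprMn [X in _ * X]cmod_sqr.
  by rewrite !raddfB /= subr0 cc//; field.
- rewrite -[X in cmod (X - _)](divfK b0) mulrC -mulrBr cmodM exprMn.
  rewrite [X in _ * X]cmod_sqr !raddfB /= -/x -/v -/s.
  (* Here |z - w|^2 = s ((x - 1/2)^2 + (v - u)^2) <= 4 (e^2 + 2 e) <= 12 e. *)
  by case/andP: x1 => xl xr; nra.
Qed.

Lemma cmod1_conj (x : R[i]) : cmod x = 1 -> x^-1 = (x^*)%C.
Proof.
move=> x1; have x0 : x != 0 by rewrite -cmod_gt0 x1.
by apply: (mulfI x0); rewrite mulfV// mulcJ x1 expr1n.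
Qed.
End UnitCircles.

(** * The fractional parts do not approach the unit circle *)

Section Recurrence.
Variables (R : realType) (G : set R[i]) (z : R[i]) (a zs : nat -> R[i]).
Hypotheses (GE : euclidean_subring G) (cfe : cf_expansion G z a zs).

(** The points near which [zs n] would eventually lie if |z_n - a_n| tended to 1. *)
Definition circle_points : set R[i] := [set w | cmod w = 1 /\
  exists b, [/\ G b, b != 0, cmod b <= 2 & cmod (w - b) = 1]].

Lemma circle_points_finite : finite_set circle_points.
Proof.
apply: sub_finite_set (finite_quadratic_roots (euclidean_subring_finite GE 4)).
move=> w [w1 [b [Gb b0 b2 wb]]] /=; have GbJ := euclidean_subringJ GE Gb.
(* Multiply |w - b|^2 = 1 by w and use that the conjugate of w is 1 / w. *)
exists (b^*)%C, (- (b * (b^*)%C)), b; split.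
- by split=> //; rewrite cmodJ; lra.
- split; first exact/(euclidean_subringN GE)/(euclidean_subringM GE).
  by rewrite cmodN cmodM cmodJ; have := cmod_ge0 b; nra.
- by split=> //; lra.
- by apply: contraNneq b0 => -[_ _ ->].
have ww : w * (w^*)%C = 1 by rewrite mulcJ w1 expr1n.
have : (w - b) * ((w - b)^*)%C = 1 by rewrite mulcJ wb expr1n.
rewrite rmorphB /= => wbE.
transitivity (w * (w * (w^*)%C - (w - b) * ((w^*)%C - (b^*)%C)) + b * (1 - w * (w^*)%C)).
  ring.
by rewrite wbE ww subrr !mulr0 addr0.
Qed.

(** On the unit circle inversion is conjugation, so the new point is conj w - conj b; it has
    distance |w| = 1 from - conj b. *)
Lemma circle_points_step w b : G b -> b != 0 -> cmod b <= 2 ->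
  cmod w = 1 -> cmod (w - b) = 1 -> circle_points (w - b)^-1.
Proof.
move=> Gb b0 b2 w1 wb; split; first by rewrite cmodV wb invr1.
exists (- (b^*)%C); split.
- exact/(euclidean_subringN GE)/(euclidean_subringJ GE).
- by rewrite oppr_eq0 -cmod_eq0 cmodJ cmod_eq0.
- by rewrite cmodN cmodJ.
- by rewrite cmod1_conj// rmorphB /= opprK subrK cmodJ.
Qed.

(** Since |z_(n+1)| = 1 / |z_n - a_n|, both |z_(n+1)| and |z_(n+1) - a_(n+1)| are near 1, so z_(n+1)
    is near a common point of two unit circles. *)
Lemma cf_near_circle_points (d : R) : 0 < d ->
  (forall r : R, r < 1 -> exists N, forall n, (N <= n)%N -> r < cmod (zs n - a n)) ->
  exists N, forall n, (N <= n)%N -> [/\ a n != 0, cmod (a n) <= 2,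
    1 < cmod (zs n), cmod (zs n) <= 2 &
    exists w, [/\ cmod w = 1, cmod (w - a n) = 1 & cmod (zs n - w) < d]].
Proof.
move=> d0 lim1.
pose e := Num.min (1 / 10) (d ^+ 2 / 100) : R.
have e0 : 0 < e by rewrite lt_min !divr_gt0// exprn_gt0.
have e10 : e <= 1 / 10 by rewrite ge_min lexx.
have ed : 100 * e <= d ^+ 2.
  have : e <= d ^+ 2 / 100 by rewrite ge_min lexx orbT.
  by rewrite ler_pdivlMr// mulrC.
have [|N rN] := lim1 (1 - e); first by lra.
exists N.+1 => -[//|n]; rewrite ltnS => Nn.
have z1 : 1 < cmod (zs n.+1).
  by rewrite (cf_step_cmod cfe) invf_gt1 ?(cf_frac_gt0 cfe) ?(cf_frac_lt1 cfe).
have zr : cmod (zs n.+1) * (1 - e) <= 1.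
  rewrite (cf_step_cmod cfe) mulrC ler_pdivrMr ?(cf_frac_gt0 cfe)// mul1r.
  exact/ltW/rN.
have r1 : 1 - e < cmod (zs n.+1 - a n.+1) by apply: rN; rewrite leqW.
have f1 := cf_frac_lt1 cfe n.+1.
have a0 : a n.+1 != 0 by apply: contraTneq f1 => ->; rewrite subr0 -leNgt ltW.
have z2 : cmod (zs n.+1) <= 10 / 9 by nra.
(* The triangle inequality gives only 19/9, but |a|^2 is an integer below 5. *)
have a2 : cmod (a n.+1) <= 2.
  have : cmod (a n.+1) <= cmod (zs n.+1) + cmod (zs n.+1 - a n.+1).
    by rewrite -[X in cmod X <= _](subKr (zs n.+1)) cmodB.
  have [k ak] := euclidean_subring_cmod2 GE (cf_digit cfe n.+1).
  have := cmod_ge0 (a n.+1) => ap le.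
  have k5 : (k < 5)%N by rewrite -(ltr_nat R) -ak; nra.
  have k4 : k%:R <= 4 :> R by rewrite (ler_nat R k 4).
  by move: k4; rewrite -ak; nra.
have a1 := euclidean_subring_cmod_ge1 GE (cf_digit cfe n.+1) a0.
(* For e <= 1/10, 1 / (1 - e)^2 <= 1 + 4 e; the final error 12 (4 e) is below d^2 since 100 e <=
   d^2. *)
have [|||w [w1 wa zw]] := @unit_circles_near R (zs n.+1) (a n.+1) (4 * e) _ a1 a2.
- by lra.
- by apply/andP; split; nra.
- by apply/andP; split; nra.
split=> //; first by lra.
exists w; split=> //.
rewrite -(@ltr_pXn2r _ 2) ?nnegrE ?cmod_ge0// ?ltW//.
by apply: le_lt_trans zw _; nra.
Qed.

(* If |zs n - a n| tended to 1, zs n would eventually follow an orbit of common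
   points of unit circles; but the distance to that orbit is multiplied by
   |zs n.+1| > 1 at each step, so it does not tend to 0. *)
Lemma cf_frac_not_cvg1 :
  exists2 r : R, r < 1 & forall N, exists2 n, (N <= n)%N & cmod (zs n - a n) <= r.
Proof.
apply: contrapT => no.
have lim1 r : r < 1 -> exists N, forall n, (N <= n)%N -> r < cmod (zs n - a n).
  move=> r1; apply: contrapT => noN; apply: no; exists r => // N.
  apply: contrapT => noz; apply: noN; exists N => n Nn.
  by rewrite ltNge; apply/negP => zr; apply: noz; exists n.
have [s s0 sep] := finite_separated circle_points_finite.
have s4 : 0 < s / 4 by rewrite divr_gt0.
have [N near] := cf_near_circle_points s4 lim1.
have [w0 [w01 w0a w0d]] : exists w, [/\ cmod w = 1, cmod (w - a N) = 1 &
    cmod (zs N - w) < s / 4] by case: (near N (leqnn N)).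
pose d0 := cmod (zs N - w0).
have d00 : 0 < d0.
  rewrite cmod_gt0 subr_eq0; apply/eqP => zw.
  by case: (near N (leqnn N)) => _ _ + _ _; rewrite zw w01 ltxx.
have in_pts n w : (N <= n)%N -> cmod w = 1 -> cmod (w - a n) = 1 -> circle_points w.
  move=> Nn w1 wa; split=> //; have [an0 an2 _ _ _] := near n Nn.
  by exists (a n); split=> //; apply: cf_digit cfe _.
(* The invariant keeps the distance to the orbit at least [d0], its positive initial value. *)
have orbit k : exists w, [/\ cmod w = 1, cmod (w - a (N + k)%N) = 1,
    d0 <= cmod (zs (N + k)%N - w) & cmod (zs (N + k)%N - w) < s / 4].
  elim: k => [|k [w [w1 wa dw ws]]]; first by exists w0; rewrite addn0; split.
  rewrite addnS; have Nk := leq_addr k N; set n := (N + k)%N in wa dw ws Nk *.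
  have [an0 an2 _ _ _] := near n Nk.
  have [_ _ z1 z2 [w' [w'1 w'a w's]]] := near n.+1 (leqW Nk).
  have wa0 : w - a n != 0 by rewrite -cmod_gt0 wa.
  have zT : cmod (zs n.+1 - (w - a n)^-1) = cmod (zs n - w) * cmod (zs n.+1).
    transitivity (cmod ((w - zs n) * zs n.+1 * (w - a n)^-1)).
      congr cmod; rewrite (cf_step cfe); have fz := cf_frac_neq0 cfe n.
      by field; rewrite wa0 fz.
    by rewrite !cmodM cmodV wa invr1 mulr1 cmod_distC.
  (* The two points differ by less than s/4 + 2 (s/4) < s, so separation identifies them. *)
  have Tw' : (w - a n)^-1 = w'.
    apply: sep.
    - exact: circle_points_step (cf_digit cfe n) an0 an2 w1 wa.
    - exact: in_pts (leqW Nk) w'1 w'a.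
    have -> : (w - a n)^-1 - w' = (zs n.+1 - w') - (zs n.+1 - (w - a n)^-1) by ring.
    by apply: le_lt_trans (cmodB _ _) _; rewrite zT; nra.
  by exists w'; split=> //; rewrite -Tw' zT; nra.
(* Some circle point eventually lies within [d0] of the state; separation makes it the orbit point,
   against the invariant. *)
have [N' near'] := cf_near_circle_points d00 lim1.
have [_ _ _ _ [w' [w'1 w'a w'd]]] := near' _ (leq_addl N N').
have [w [w1 wa dw ws]] := orbit N'.
have ww' : w = w'.
  apply: sep; [exact: in_pts (leq_addr _ _) w1 wa|exact: in_pts (leq_addr _ _) w'1 w'a|].
  have -> : w - w' = (zs (N + N')%N - w') - (zs (N + N')%N - w) by ring.
  by apply: le_lt_trans (cmodB _ _) _; lra.
by move: w'd; rewrite -ww' ltNge dw.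
Qed.
End Recurrence.

(** * Infinite sets of indices and the pigeonhole principle *)

Section InfiniteSets.

Lemma frequently_infinite (A : set nat) :
  (forall N, exists2 n, (N <= n)%N & A n) -> infinite_set A.
Proof.
move=> freq /finite_seqP[l Al].
have [n ln An] := freq (\max_(i <- l) i).+1.
have : n \in l by move: An; rewrite Al.
by move=> nl; move: ln; rewrite ltnNge (@leq_bigmax_seq _ l xpredT id).
Qed.

Lemma infinite_fiber (T : Type) (A : set nat) (f : nat -> T) : infinite_set A ->
  finite_set (f @` A) -> exists t, infinite_set [set n | A n /\ f n = t].
Proof.
move=> Ainf fAfin; apply: contrapT => nofib; apply: Ainf.
apply: (@sub_finite_set _ _ (\bigcup_(t in f @` A) [set n | A n /\ f n = t])).
  by move=> n An; exists (f n) => //; exists n.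
apply: bigcup_finite => // t _; apply: contrapT => tinf.
by apply: nofib; exists t.
Qed.
End InfiniteSets.

(** * States, digits and the frequency of good indices *)

Section States.
Variables (R : realType) (G : set R[i]) (z : R[i]) (a zs : nat -> R[i]).
Hypotheses (GE : euclidean_subring G) (cfe : cf_expansion G z a zs).

Lemma cf_state_outside n : outside_field G z -> outside_field G (zs n).
Proof.
move=> zK; elim: n => [|n IH]; first by case: cfe => _ ->.
move=> [x Gx [y [Gy /eqP y0] xyE]]; apply: IH.
have zxy : zs n - a n = y / x.
  by rewrite -[LHS]invrK -(cf_step cfe) -xyE invf_div.
(* For x = 0 the convention 0^-1 = 0 would make z_n - a_n vanish. *)
have x0 : x != 0.
  by apply: contraTneq (cf_frac_neq0 cfe n) => x0; rewrite zxy x0 invr0 mulr0 eqxx.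
exists (a n * x + y).
  exact: (euclidean_subringD GE (euclidean_subringM GE (cf_digit cfe n) Gx) Gy).
exists x; first by split=> //; exact/eqP.
by rewrite mulrDl mulfK// -zxy addrC subrK.
Qed.

(** A digit lies within 1 of its state, so discreteness leaves finitely many digits for each
    state. *)
Lemma cf_state_digit_finite (A : set nat) : finite_set (zs @` A) ->
  finite_set ((fun n => (zs n, a n)) @` A).
Proof.
move=> zA; apply: (@sub_finite_set _ _ (\bigcup_(x in zs @` A)
    ([set x] `*` [set b | G b /\ cmod b <= cmod x + 1]))).
  move=> _ [n An <-]; exists (zs n); first by exists n.
  split=> //=; split; first exact: (cf_digit cfe).
  rewrite -[X in cmod X <= _](subKr (zs n)) (le_trans (cmodB _ _))// lerD2l.
  exact/ltW/(cf_frac_lt1 cfe).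
by apply: bigcup_finite => // x _; apply: finite_setX; [exact: finite_set1|
  exact: (euclidean_subring_finite GE)].
Qed.

Lemma cf_frac_le_radius n : (1 <= n)%N -> cmod (zs n - a n) <= cf_radius a zs.
Proof.
move=> n1; apply: ub_le_sup; last by exists n.
by exists 1 => _ [m _ <-]; apply/ltW/(cf_frac_lt1 cfe).
Qed.

Lemma cf_den_cmod2 n : exists k : nat, cmod (cf_den a n) ^+ 2 = k%:R.
Proof. exact/(euclidean_subring_cmod2 GE)/(cf_den_subring GE cfe). Qed.

Lemma cf_den_nondecreasing_often N :
  exists2 n, (N <= n)%N & cmod (cf_den a n) <= cmod (cf_den a n.+1).
Proof.
apply: contrapT => no.
have dec n : (N <= n)%N -> cmod (cf_den a n.+1) < cmod (cf_den a n).
  by move=> Nn; rewrite ltNge; apply/negP => qq; apply: no; exists n.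
have [k kE] := choice cf_den_cmod2.
have kdec n : (N <= n)%N -> (k n.+1 < k n)%N.
  move=> /dec qq; rewrite -(ltr_nat R) -!kE.
  by rewrite ltr_pXn2r ?nnegrE ?cmod_ge0.
have kj j : (k (N + j)%N + j <= k N)%N.
  elim: j => [|j IH]; first by rewrite !addn0.
  by rewrite !addnS -addSn (leq_trans _ IH)// leq_add2r kdec// leq_addr.
by have := kj (k N).+1; rewrite addnS ltnNge leq_addl.
Qed.

(* A nonincreasing |q_n| is squeezed between 0 and q_0 = 1; as consecutive
   denominators are coprime it never vanishes, so it is constant. *)
Lemma cf_den_monotonic : monotonic_modulus (cf_denom a) ->
  forall n, cmod (cf_den a n.+1) <= cmod (cf_den a n.+2).
Proof.
move=> mono n; rewrite !cf_denS.
case: mono => mono; first by have := mono n n.+1 (leqnSn n); rewrite ler_cmod.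
have le m m' : (m <= m')%N -> cmod (cf_denom a m') <= cmod (cf_denom a m).
  by move=> /mono; rewrite ler_cmod.
have q1 m : cmod (cf_denom a m) <= 1 by have := le 0%N m (leq0n m); rewrite cmod1.
apply: le_trans (q1 n) _; rewrite -cf_denS.
apply: (euclidean_subring_cmod_ge1 GE (cf_den_subring GE cfe _)).
apply/eqP => q0; have q0' : cf_den a n.+3 = 0.
  apply/eqP; rewrite -cmod_eq0 eq_le cmod_ge0 andbT cf_denS.
  by apply: le_trans (le n.+1 n.+2 (leqnSn _)) _; rewrite -cf_denS q0 cmod0.
have := cf_det a n.+2; rewrite q0 q0' !mulr0 subrr => /esym/eqP.
by rewrite signr_eq0.
Qed.

(** Each alternative makes one condition hold at every n >= 1, while the other condition holds for
    arbitrarily large n. *)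
Lemma cf_good_often : cf_radius a zs < 1 \/ monotonic_modulus (cf_denom a) ->
  exists2 r : R, r < 1 & forall N, exists2 n, (N <= n)%N &
    cmod (zs n - a n) <= r /\ cmod (cf_den a n) <= cmod (cf_den a n.+1).
Proof.
case=> [r1|mono].
  exists (cf_radius a zs) => // N.
  have [n Nn qq] := cf_den_nondecreasing_often N.+1.
  exists n; first exact: ltnW.
  by split=> //; apply: cf_frac_le_radius; apply: leq_ltn_trans Nn.
have [r r1 zr] := cf_frac_not_cvg1 GE cfe.
exists r => // N; have [[//|n] Nn zn] := zr N.+1.
by exists n.+1; [exact: ltnW|split=> //; exact: cf_den_monotonic].
Qed.
End States.

(** * Recurring states, periodicity and finiteness *)

Theorem corollary3p5 (R : realType) (G : set R[i]) (z : R[i])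
    (a zs : nat -> R[i])
    (G_euclidean : euclidean_subring G)
    (z_surd : quadratic_surd G z)
    (a_expansion : cf_expansion G z a zs)
    (radius_or_monotonic :
      cf_radius a zs < 1 \/ monotonic_modulus (cf_denom a)) :
  ((exists zeta b : R[i],
      [/\ outside_field G zeta, G b &
          infinite_set
            [set n : nat | [/\ (1 <= n)%N, zs n = zeta & a n = b]]]) /\
   (associated_with_algorithm G a zs -> eventually_periodic a)) /\
  (cf_radius a zs < 1 -> monotonic_modulus (cf_denom a) ->
     finite_set [set zs n | n in [set n : nat | (1 <= n)%N]] /\
     finite_set [set a n | n in [set n : nat | (1 <= n)%N]]).
Proof.
have zK : outside_field G z by case: z_surd.
have [zeta [b [zetaK Gb fib]]] : exists zeta b : R[i],
    [/\ outside_field G zeta, G b &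
     infinite_set [set n : nat | [/\ (1 <= n)%N, zs n = zeta & a n = b]]].
  have [r r1 good] := cf_good_often G_euclidean a_expansion radius_or_monotonic.
  (* Successors, because a good index n controls the state z_(n+1). *)
  pose A := [set n.+1 | n in [set n | cmod (zs n - a n) <= r /\
    cmod (cf_den a n) <= cmod (cf_den a n.+1)]].
  have Ainf : infinite_set A.
    apply: frequently_infinite => N; have [n Nn gn] := good N.
    by exists n.+1; [exact: leqW|exists n].
  have zA : finite_set (zs @` A).
    rewrite image_comp.
    exact: (cf_good_states_finite G_euclidean a_expansion z_surd r1).
  have [[zeta b] fib] :=
    infinite_fiber Ainf (cf_state_digit_finite G_euclidean a_expansion zA).
  have [n [_ [nz na]]] := infinite_setN0 fib.
  exists zeta, b; split.
  + by rewrite -nz; exact: (cf_state_outside G_euclidean a_expansion).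
  + by rewrite -na; exact: (cf_digit a_expansion).
  by apply: sub_infinite_set fib => m [[k _ <-] [zk ak]].
split; [split|].
- by exists zeta, b.
- move=> [f _ af].
  have [n [_ zn _]] := infinite_setN0 fib.
  have [m nm zm] : exists2 m, (n < m)%N & zs m = zeta.
    apply: contrapT => nom; apply: fib; apply: sub_finite_set (finite_II n.+1).
    move=> m [_ zm _] /=; rewrite ltnS leqNgt; apply/negP => nm.
    by apply: nom; exists m.
  (* With an algorithm the state determines the digit and hence the next state, so the coincidence
     at n and m propagates. *)
  have zs_shift k : zs (m + k)%N = zs (n + k)%N.
    elim: k => [|k IH]; first by rewrite !addn0 zn zm.
    by rewrite !addnS !(cf_step a_expansion) !af IH.
  exists (m - n)%N, n; split=> [|k nk]; first by rewrite subn_gt0.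
  have -> : (k + (m - n) = m + (k - n))%N by lia.
  by rewrite !af zs_shift subnKC.
move=> r1 mono.
have zfin : finite_set (zs @` [set n | (1 <= n)%N]).
  (* [zs 1] is set apart: its predecessor has index 0, which the radius does not cover. *)
  apply: (@sub_finite_set _ _ ([set zs 1%N] `|` [set zs n.+1 | n in [set n |
    cmod (zs n - a n) <= cf_radius a zs /\
    cmod (cf_den a n) <= cmod (cf_den a n.+1)]])).
    move=> _ [[//|[|n]] _ <-]; first by left.
    right; exists n.+1 => //; split; first exact: (cf_frac_le_radius a_expansion).
    exact: (cf_den_monotonic G_euclidean a_expansion).
  rewrite finite_setU; split; first exact: finite_set1.
  exact: (cf_good_states_finite G_euclidean a_expansion z_surd r1).
split=> //.
have := finite_image snd (cf_state_digit_finite G_euclidean a_expansion zfin).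
by rewrite image_comp.
Qed.
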